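(* Let $(M^n,g)$ be a (smooth) Riemannian manifold of dimension $n$, let $h$ be a smooth symmetric covariant $2$-tensor field on $M$, and let $$h = h_0 + \frac{1}{n}(\operatorname{tr}_g h)\,g$$ be its pointwise orthogonal decomposition into its trace-free part $h_0$ (so $\operatorname{tr}_g h_0=0$) and its pure-trace part. If $h$ satisfies the Chen–Nagano gauge condition $$\delta h = -\frac12\, d(\operatorname{tr}_g h),$$ then $$\delta h_0 = -\frac{n-2}{2n}\, d(\operatorname{tr}_g h).$$
   Context: For a symmetric $2$-tensor $h$ with components $h_{ij}$, $\operatorname{tr}_g h = g^{ij}h_{ij}$. The divergence is defined with the sign convention $(\delta h)_j = -\nabla^i h_{ij}$, where $\nabla$ is the Levi-Civita connection of $g$ and $\nabla^i = g^{ij}\nabla_j$. *)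

(* Defs.v *)
From HB Require Import structures.
From mathcomp Require Import all_boot all_order all_algebra.
From mathcomp Require Import all_classical all_reals all_analysis.

Set Implicit Arguments.
Unset Strict Implicit.
Unset Printing Implicit Defensive.

Import Order.TTheory GRing.Theory Num.Theory.
Import numFieldNormedType.Exports.

Local Open Scope classical_set_scope.
Local Open Scope ring_scope.

(* C^k on U: all partial derivatives of order at most k exist and are
   continuous at every point of U.  Only used with U open, so the values of f
   outside U are irrelevant. *)
Fixpoint Ck_on (R : realType) (n k : nat) (U : set 'rV[R]_n)
    (f : 'rV[R]_n -> R) : Prop :=
  (forall x, U x -> {for x, continuous f}) /\
  match k with
  | 0 => True
  | k'.+1 => forall i : 'I_n,
      (forall x, U x -> derivable f x (delta_mx 0 i)) /\
      Ck_on k' U (fun x => 'D_(delta_mx 0 i) f x)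
  end.

Definition smooth_on (R : realType) (n : nat) (U : set 'rV[R]_n)
    (f : 'rV[R]_n -> R) : Prop := forall k, Ck_on k U f.

(* A homeomorphism between an open subset of T and an open subset of R^n.
   Both directions are total functions: chart_map is meaningful on chart_dom
   only, chart_inv on the image of chart_dom only. *)
Record chart (R : realType) (n : nat) (T : topologicalType) := Chart {
  chart_dom : set T;
  chart_map : T -> 'rV[R]_n;
  chart_inv : 'rV[R]_n -> T;
  chart_dom_open : open chart_dom;
  chart_img_open : open (chart_map @` chart_dom);
  chart_mapK : forall p, chart_dom p -> chart_inv (chart_map p) = p;
  chart_map_cont : forall p, chart_dom p -> {for p, continuous chart_map};
  chart_inv_cont : forall x, (chart_map @` chart_dom) x ->
    {for x, continuous chart_inv}
}.

(* A smooth atlas; it need not be maximal, since any smooth atlas determines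
   the smooth structure. *)
Record smooth_manifold (R : realType) (n : nat) := SmoothManifold {
  carrier :> topologicalType;
  manifold_hausdorff : hausdorff_space carrier;
  manifold_second_countable : @second_countable carrier;
  atlas_index : Type;
  atlas : atlas_index -> chart R n carrier;
  atlas_cover : forall p, exists a, chart_dom (atlas a) p;
  atlas_compat : forall (a b : atlas_index) (k : 'I_n),
    smooth_on (chart_map (atlas a) @`
                 (chart_dom (atlas a) `&` chart_dom (atlas b)))
      (fun x => chart_map (atlas b) (chart_inv (atlas a) x) 0 k)
}.

Section Manifold.
Variables (R : realType) (n : nat) (M : smooth_manifold R n).
Implicit Types (a b : atlas_index M) (p : M) (f : M -> R).

Definition in_chart a p : Prop := chart_dom (atlas a) p.

Definition chart_at p : atlas_index M := projT1 (cid (atlas_cover p)).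

(* (df/dx^i)(p), for x^1, ..., x^n the coordinates of the chart a *)
Definition partial a (i : 'I_n) f p : R :=
  'D_(delta_mx 0 i) (f \o chart_inv (atlas a)) (chart_map (atlas a) p).

Definition smooth_in_chart a f : Prop :=
  smooth_on (chart_map (atlas a) @` chart_dom (atlas a))
    (f \o chart_inv (atlas a)).

(* jacobian_at a b p k i = (dy^k/dx^i)(p), for x the coordinates of the chart a
   and y those of the chart b *)
Definition jacobian_at a b p : 'M[R]_n :=
  \matrix_(k, i) partial a i (fun q => chart_map (atlas b) q 0 k) p.

(* Tensor fields are given by their components in each chart of the atlas;
   w a p is meaningful for p in the domain of a only. *)
Local Notation components1 := (atlas_index M -> M -> 'rV[R]_n).
Local Notation components2 := (atlas_index M -> M -> 'M[R]_n).

Record sym_tensor2 := SymTensor2 {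
  sym_tensor2_comp :> components2;
  sym_tensor2_smooth : forall a i j,
    smooth_in_chart a (fun p => sym_tensor2_comp a p i j);
  sym_tensor2_sym : forall a p, in_chart a p ->
    (sym_tensor2_comp a p)^T = sym_tensor2_comp a p;
  sym_tensor2_transform : forall a b p, in_chart a p -> in_chart b p ->
    sym_tensor2_comp a p =
      (jacobian_at a b p)^T *m sym_tensor2_comp b p *m jacobian_at a b p
}.

Record riemannian_metric := RiemannianMetric {
  metric_tensor :> sym_tensor2;
  metric_pos : forall a p, in_chart a p -> forall v : 'rV[R]_n, v != 0 ->
    0 < (v *m metric_tensor a p *m v^T) 0 0
}.

(* conn_coef a p i j k is the coefficient Gamma^k_{ij}(p) in the chart a, with
   the convention nabla_{d/dx^i} (d/dx^j) = Gamma^k_{ij} d/dx^k. *)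
Record affine_connection := AffineConnection {
  conn_coef : atlas_index M -> M -> 'I_n -> 'I_n -> 'I_n -> R;
  conn_smooth : forall a i j k,
    smooth_in_chart a (fun p => conn_coef a p i j k);
  conn_transform : forall a b p, in_chart a p -> in_chart b p ->
    forall i j c,
    \sum_(k < n) jacobian_at a b p c k * conn_coef a p i j k =
      partial a i (fun q => jacobian_at a b q c j) p +
      \sum_(d < n) \sum_(e < n)
        jacobian_at a b p d i * jacobian_at a b p e j * conn_coef b p d e c
}.

(* (nabla_k h)_{ij} *)
Definition cov_deriv2 (nabla : affine_connection) (h : components2)
    a p (k i j : 'I_n) : R :=
  partial a k (fun q => h a q i j) p
  - \sum_(l < n) conn_coef nabla a p k i l * h a p l j
  - \sum_(l < n) conn_coef nabla a p k j l * h a p i l.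

Definition torsion_free (nabla : affine_connection) : Prop :=
  forall a p, in_chart a p -> forall i j k,
    conn_coef nabla a p i j k = conn_coef nabla a p j i k.

Definition metric_compatible (g : riemannian_metric)
    (nabla : affine_connection) : Prop :=
  forall a p, in_chart a p -> forall k i j, cov_deriv2 nabla g a p k i j = 0.

Definition levi_civita (g : riemannian_metric) (nabla : affine_connection) :
  Prop := torsion_free nabla /\ metric_compatible g nabla.

(* g^{ij} h_{ij} in the chart a *)
Definition trace_in (g : riemannian_metric) (h : components2) a p : R :=
  \sum_(i < n) \sum_(j < n) invmx (g a p) i j * h a p i j.

(* tr_g h as a function on M; by trace_chartE below the choice of the chart
   around p does not matter. *)
Definition trace (g : riemannian_metric) (h : components2) (p : M) : R :=
  trace_in g h (chart_at p) p.

(* (delta h)_j = - g^{ik} nabla_k h_{ij} *)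
Definition divergence (g : riemannian_metric) (nabla : affine_connection)
    (h : components2) : components1 := fun a p =>
  \row_j (- \sum_(i < n) \sum_(k < n)
              invmx (g a p) i k * cov_deriv2 nabla h a p k i j).

Definition exterior_d (f : M -> R) : components1 := fun a p =>
  \row_j partial a j f p.

Definition trace_free_part (g : riemannian_metric) (h : sym_tensor2) :
    components2 := fun a p =>
  h a p - (n%:R^-1 * trace g h p) *: g a p.

Definition chen_nagano (g : riemannian_metric) (nabla : affine_connection)
    (h : sym_tensor2) : Prop :=
  forall a p, in_chart a p ->
    divergence g nabla h a p = - (1 / 2) *: exterior_d (trace g h) a p.

Lemma chart_atP p : in_chart (chart_at p) p.
Proof. exact: projT2 (cid (atlas_cover p)). Qed.

Lemma metric_unitmx (g : riemannian_metric) a p :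
  in_chart a p -> g a p \in unitmx.
Proof.
move=> ap; rewrite -row_free_unit -kermx_eq0; apply/eqP/row_matrixP => i.
rewrite row0; apply/eqP/negPn/negP => /(metric_pos g ap).
by rewrite -row_mul mulmx_ker row0 mul0mx mxE ltxx.
Qed.

Lemma trace_inE (g : riemannian_metric) (h : components2) a p :
  in_chart a p -> trace_in g h a p = \tr (invmx (g a p) *m h a p).
Proof.
move=> ap; have gs : (invmx (g a p))^T = invmx (g a p).
  by rewrite trmx_inv sym_tensor2_sym.
rewrite /trace_in exchange_big /= /mxtrace; apply: eq_bigr => i _.
by rewrite mxE; apply: eq_bigr => j _; rewrite -[in RHS]gs [in RHS]mxE.
Qed.

Lemma trace_chartE (g : riemannian_metric) (h : sym_tensor2) a p :
  in_chart a p -> trace g h p = trace_in g h a p.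
Proof.
move=> ap; rewrite /trace; set b := chart_at p.
have bp : in_chart b p := chart_atP p.
rewrite !trace_inE// (sym_tensor2_transform g bp ap).
rewrite (sym_tensor2_transform h bp ap); set J := jacobian_at b a p.
have := metric_unitmx g bp; rewrite (sym_tensor2_transform g bp ap) -/J.
rewrite unitmx_mul => /andP[]; rewrite unitmx_mul => /andP[JTu gu] Ju.
have -> : invmx (J^T *m g a p *m J) =
    invmx J *m invmx (g a p) *m invmx J^T.
  apply: (@row_free_inj _ _ _ _ (J^T *m g a p *m J)).
    by rewrite row_free_unit !unitmx_mul JTu gu Ju.
  rewrite /mulmxr mulVmx ?unitmx_mul ?JTu ?gu ?Ju//.
  by rewrite !mulmxA mulmxKV// mulmxKV// mulVmx.
rewrite !mulmxA mulmxKV// mxtrace_mulC !mulmxA mulmxV// mul1mx.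
by [].
Qed.

Lemma trace_trace_free_part (g : riemannian_metric) (h : sym_tensor2) p :
  (0 < n)%N -> trace g (trace_free_part g h) p = 0.
Proof.
move=> n0; have pp := chart_atP p.
rewrite /trace trace_inE// /trace_free_part mulmxBr linearB /=.
rewrite -trace_inE// -scalemxAr linearZ /= mulVmx ?metric_unitmx//.
rewrite mxtrace1 mulrAC mulVf ?mul1r ?subrr//.
by rewrite pnatr_eq0 -lt0n.
Qed.

End Manifold.

(* Main.v *)
Require Import Defs.
From HB Require Import structures.
From mathcomp Require Import all_boot all_order all_algebra.
From mathcomp Require Import perm.
From mathcomp Require Import all_classical all_reals all_analysis.
From mathcomp Require Import ring.

Import Order.TTheory GRing.Theory Num.Theory.
Import numFieldNormedType.Exports.

Local Open Scope ring_scope.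

(** The pure-trace part (tau/n) g, with tau = tr_g h, has divergence
    - (1/n) d tau: the Leibniz rule splits nabla_k ((tau/n) g_{ij}) into
    (1/n) (d_k tau) g_{ij} and a multiple of nabla_k g_{ij}, which vanishes
    because the connection is compatible with the metric, and contracting the
    remaining term with g^{ik} turns d_k tau into d_j tau.  Hence
    delta h_0 = delta h + (1/n) d tau (divergence_trace_free_part), and the
    gauge condition gives the factor - 1/2 + 1/n = - (n - 2) / (2 n).

    The analytic point is that the Leibniz rule requires tau to be
    differentiable in the given chart.  Near any point of the chart tau is the
    contraction g^{ij} h_{ij} of the components in that chart
    (trace_chartE), and the entries of the inverse metric are differentiable
    because Cramer's rule writes them as quotients of polynomials in the
    entries of the metric (derivable_invmx). *)

(** * Directional derivatives of matrix operations *)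

Section MatrixDerivable.
Variables (K : numFieldType) (V : normedModType K) (x v : V).

Lemma derivable_bigsum (I : Type) (r : seq I) (P : pred I) (F : I -> V -> K) :
  (forall i, derivable (F i) x v) ->
  derivable (fun y => \sum_(i <- r | P i) F i y) x v.
Proof.
move=> dF; elim: r => [|i r IHr].
  under eq_fun do rewrite big_nil; exact: derivable_cst.
under eq_fun do rewrite big_cons; case: (P i) => //.
exact: (derivableD (dF i) IHr).
Qed.

Lemma derivable_bigprod (I : Type) (r : seq I) (P : pred I) (F : I -> V -> K) :
  (forall i, derivable (F i) x v) ->
  derivable (fun y => \prod_(i <- r | P i) F i y) x v.
Proof.
move=> dF; elim: r => [|i r IHr].
  under eq_fun do rewrite big_nil; exact: derivable_cst.
under eq_fun do rewrite big_cons; case: (P i) => //.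
exact: (derivableM (dF i) IHr).
Qed.

Lemma derivable_det m (A : V -> 'M[K]_m) :
  (forall i j, derivable (fun y => A y i j) x v) ->
  derivable (fun y => \det (A y)) x v.
Proof.
move=> dA; apply: derivable_bigsum => s.
apply: (@derivableM _ _ (cst ((-1) ^+ odd_perm s))); first exact: derivable_cst.
exact: derivable_bigprod.
Qed.

(** Invertibility is required on a neighbourhood of x: [invmx] is the identity
    on singular matrices, so Cramer's formula has to hold around x and not only
    at x. *)
Lemma derivable_invmx m (A : V -> 'M[K]_m) (i j : 'I_m) :
  (\forall y \near x, A y \in unitmx) ->
  (forall i j, derivable (fun y => A y i j) x v) ->
  derivable (fun y => invmx (A y) i j) x v.
Proof.
move=> Au dA.
have cramer : {near x, (fun y => (\det (A y))^-1 * cofactor (A y) j i)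
                       =1 (fun y => invmx (A y) i j)}.
  by apply: filterS Au => y Ay /=; rewrite /invmx Ay !mxE.
apply: (near_eq_derivable cramer).
have detx : \det (A x) != 0.
  by have := nbhs_singleton Au; rewrite unitmxE unitfE.
apply: (@derivableM _ _ (fun y => (\det (A y))^-1)).
  by apply: derivableV => //; exact: derivable_det.
apply: (@derivableM _ _ (cst ((-1) ^+ (j + i)))); first exact: derivable_cst.
apply: derivable_det => k l.
by under eq_fun do rewrite !mxE; exact: dA.
Qed.

End MatrixDerivable.

(** * Calculus in a chart *)

Section ChartCalculus.
Context {R : realType} {n : nat} {M : smooth_manifold R n}.
Implicit Types (a : atlas_index M) (p : M) (f : M -> R).

Definition partial_derivable a i f p : Prop :=
  derivable (f \o chart_inv (atlas a)) (chart_map (atlas a) p)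
    (delta_mx 0 i).

Lemma smooth_partial_derivable {a p} i {f} : in_chart a p ->
  smooth_in_chart a f -> partial_derivable a i f p.
Proof. by move=> ap /(_ 1%N)[_ /(_ i)[df _]]; apply: df; exists p. Qed.

Lemma near_in_chart {a p} : in_chart a p ->
  \forall y \near chart_map (atlas a) p, in_chart a (chart_inv (atlas a) y).
Proof.
move=> ap.
have : nbhs (chart_map (atlas a) p)
    (chart_map (atlas a) @` chart_dom (atlas a))%classic.
  by apply: open_nbhs_nbhs; split; [exact: chart_img_open|exists p].
by apply: filterS => _ [q aq <-]; rewrite /in_chart chart_mapK.
Qed.

Lemma partial_subM {a p i u f w} : in_chart a p ->
  partial_derivable a i u p -> partial_derivable a i f p ->
  partial_derivable a i w p ->
  partial a i (fun q => u q - f q * w q) p =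
    partial a i u p - (f p * partial a i w p + w p * partial a i f p).
Proof.
move=> ap du df dw.
rewrite /partial (deriveB du (derivableM df dw)) (deriveM df dw) /=.
by rewrite chart_mapK.
Qed.

(** By definition the trace at a point uses a chart chosen at that point, and
    this choice may vary erratically from point to point; invariance under
    change of charts makes it a smooth expression in the single chart a near
    p. *)
Lemma trace_partial_derivable (g : riemannian_metric M) (h : sym_tensor2 M)
    {a p} i : in_chart a p -> partial_derivable a i (trace g h) p.
Proof.
move=> ap; have nearU := near_in_chart ap.
have local : {near chart_map (atlas a) p,
    (trace_in g h a \o chart_inv (atlas a))
    =1 (trace g h \o chart_inv (atlas a))}.
  by apply: filterS nearU => y ay /=; rewrite (trace_chartE g h ay).
apply: (near_eq_derivable local).
apply: derivable_bigsum => k; apply: derivable_bigsum => l.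
apply: derivableM; last first.
  exact: (smooth_partial_derivable i ap (sym_tensor2_smooth h a k l)).
apply: (@derivable_invmx _ _ _ _ _ (fun y => g a (chart_inv (atlas a) y))).
  by apply: filterS nearU => y; exact: metric_unitmx.
move=> k' l'.
exact: (smooth_partial_derivable i ap (sym_tensor2_smooth g a k' l')).
Qed.

End ChartCalculus.

(** * Divergence of the trace-free part *)

Section TraceFreePart.
Variables (R : realType) (n : nat) (M : smooth_manifold R n).
Variables (g : riemannian_metric M) (nabla : affine_connection M).
Hypothesis g_parallel : metric_compatible g nabla.

(** The Christoffel terms are linear over functions, so only the derivative of
    the factor (tr_g h) / n survives once nabla g = 0. *)
Lemma cov_deriv2_trace_free_part (h : sym_tensor2 M) a p k i j :
  in_chart a p ->
  cov_deriv2 nabla (trace_free_part g h) a p k i j =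
    cov_deriv2 nabla h a p k i j
    - n%:R^-1 * partial a k (trace g h) p * g a p i j.
Proof.
move=> ap; have dtau := trace_partial_derivable g h k ap.
have dh := smooth_partial_derivable k ap (sym_tensor2_smooth h a i j).
have dg := smooth_partial_derivable k ap (sym_tensor2_smooth g a i j).
set c : R := n%:R^-1.
pose f q := c * trace g h q.
have df : partial_derivable a k f p.
  exact: (derivableM (derivable_cst c _ _) dtau).
have pf : partial a k f p = c * partial a k (trace g h) p.
  rewrite /partial (deriveM (derivable_cst c _ _) dtau) derive_cst.
  by rewrite scaler0 addr0.
have entry q i' j' :
    trace_free_part g h a q i' j' = h a q i' j' - f q * g a q i' j'.
  by rewrite !mxE.
have contract (s t u : 'I_n -> R) :
    \sum_l s l * (t l - f p * u l)
    = \sum_l s l * t l - f p * \sum_l s l * u l.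
  by rewrite mulr_sumr -sumrB; apply: eq_bigr => l _; ring.
rewrite /cov_deriv2.
under eq_fun do rewrite entry.
rewrite (partial_subM ap dh df dg) pf.
under eq_bigr do rewrite entry.
rewrite contract.
under [X in _ - X = _]eq_bigr do rewrite entry.
rewrite contract.
(* nabla_k g_{ij} = 0, solved for the coordinate derivative of g_{ij} *)
have := g_parallel _ _ ap k i j; rewrite /cov_deriv2 => /eqP.
rewrite subr_eq0 subr_eq => /eqP ->.
ring.
Qed.

Lemma divergence_trace_free_part (h : sym_tensor2 M) a p : in_chart a p ->
  divergence g nabla (trace_free_part g h) a p =
    divergence g nabla h a p + n%:R^-1 *: exterior_d (trace g h) a p.
Proof.
move=> ap; apply/rowP => j; rewrite !mxE.
pose dtau k := partial a k (trace g h) p.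
have inv_metric (k : 'I_n) :
    \sum_i invmx (g a p) i k * g a p i j = (j == k)%:R.
  have <- : (g a p *m invmx (g a p)) j k = (j == k)%:R.
    by rewrite mulmxV ?metric_unitmx// mxE.
  rewrite mxE; apply: eq_bigr => i _.
  by rewrite mulrC -{1}(sym_tensor2_sym g ap) mxE.
have raise : \sum_i \sum_k invmx (g a p) i k * (n%:R^-1 * dtau k * g a p i j)
    = n%:R^-1 * dtau j.
  rewrite exchange_big /=.
  transitivity (\sum_k n%:R^-1 * dtau k * (j == k)%:R).
    apply: eq_bigr => k _; rewrite -inv_metric mulr_sumr.
    by apply: eq_bigr => i _; ring.
  rewrite (bigD1 j)//= eqxx mulr1 big1 => [|k]; first by rewrite addr0.
  by rewrite eq_sym => /negPf ->; rewrite mulr0.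
rewrite -raise -[X in _ = _ + X]opprK -opprD; congr (- _).
rewrite -sumrB; apply: eq_bigr => i _; rewrite -sumrB; apply: eq_bigr => k _.
by rewrite cov_deriv2_trace_free_part// mulrBr.
Qed.

End TraceFreePart.

Theorem proposition3p1 (R : realType) (n : nat) (n_gt0 : (0 < n)%N)
    (M : smooth_manifold R n) (g : riemannian_metric M)
    (nabla : affine_connection M) (nablaLC : levi_civita g nabla)
    (h : sym_tensor2 M) (hCN : chen_nagano g nabla h) :
  forall (a : atlas_index M) (p : M), in_chart a p ->
    divergence g nabla (trace_free_part g h) a p =
      - ((n%:R - 2) / (2 * n%:R)) *: exterior_d (trace g h) a p.
Proof.
move=> a p ap; rewrite divergence_trace_free_part//; last by case: nablaLC.
rewrite hCN// -scalerDl; congr (_ *: _).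
have n_neq0 : n%:R != 0 :> R by rewrite pnatr_eq0 -lt0n.
by field.
Qed.
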